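(* Let $k\ge 2$ be an integer. A graph $G$ admits a signing $\sigma:E(G)\to\{+1,-1\}$ in which every $2k$-cycle of $G$ is unbalanced if and only if the $2k$-cycles of $G$ have no odd dependence. Equivalently, $G$ admits such a signing if and only if every subfamily of $\mathcal C_{2k}(G)$ whose members' edge sets have empty symmetric difference has even cardinality.
   Context: All graphs are finite and simple. The sign of a cycle in a signed graph is the product of its edge signs; a cycle is balanced if its sign is $+1$ and unbalanced if its sign is $-1$. $\mathcal C_{2k}(G)$ is the set of simple $2k$-cycles (as subgraphs) of $G$, and $\chi_C\in\mathbb F_2^{E(G)}$ is the edge-incidence vector of $C\in\mathcal C_{2k}(G)$. A subfamily (subset) $\mathcal D\subseteq\mathcal C_{2k}(G)$ is a dependence if $\sum_{C\in\mathcal D}\chi_C=0$ in $\mathbb F_2^{E(G)}$, i.e. every edge lies in an even number of cycles of $\mathcal D$. A dependence is odd if $|\mathcal D|$ is odd. *)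

(* Defs.v *)
From HB Require Import structures.
From mathcomp Require Import all_boot all_order all_algebra.

Set Implicit Arguments.
Unset Strict Implicit.
Unset Printing Implicit Defensive.

Import GRing.Theory.
Local Open Scope ring_scope.

Record sgraph := SGraph {
  vertex :> finType;
  adj : rel vertex;
  adj_sym : symmetric adj;
  adj_irr : irreflexive adj }.

Definition edge_set (G : sgraph) : {set {set G}} :=
  [set f : {set G} | [exists x, exists y, adj x y && (f == [set x; y])]].

Definition edge (G : sgraph) : finType := {f : {set G} | f \in edge_set G}.

(* A subgraph is given by its vertex set and its edge set. The incidence
   condition is not part of the type; it holds for members of [cycles]. *)
Definition subgraph (G : sgraph) : finType := ({set G} * {set edge G})%type.
Definition subgraph_vertices (G : sgraph) (H : subgraph G) : {set G} := H.1.
Definition subgraph_edges (G : sgraph) (H : subgraph G) : {set edge G} := H.2.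

Definition traces_cycle (G : sgraph) (c : seq G) (H : subgraph G) : bool :=
  [&& 2 < size c, uniq c, cycle (@adj G) c,
      subgraph_vertices H == [set x in c]
    & val @: subgraph_edges H == [set [set x; next c x] | x in c]]%N.

(* Cycles are subgraphs: the tuples that trace the same cycle from another
   starting point or in the other direction yield a single member. *)
Definition cycles (n : nat) (G : sgraph) : {set subgraph G} :=
  [set H | [exists c : n.-tuple G, traces_cycle c H]].

Record signing (G : sgraph) := Signing {
  sgn_of :> edge G -> int;
  sgn_ofP : forall f, sgn_of f = 1 \/ sgn_of f = -1 }.

Definition cycle_sign (G : sgraph) (sigma : signing G) (C : subgraph G) : int :=
  \prod_(f in subgraph_edges C) sigma f.

Definition unbalanced (G : sgraph) (sigma : signing G) (C : subgraph G) : Prop :=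
  cycle_sign sigma C = -1.

Definition incidence (G : sgraph) (C : subgraph G) : {ffun edge G -> 'F_2} :=
  [ffun f => (f \in subgraph_edges C)%:R].

Definition dependence (n : nat) (G : sgraph) (D : {set subgraph G}) : Prop :=
  D \subset cycles n G /\ \sum_(C in D) incidence C = 0.

Definition symdiff (T : finType) (A B : {set T}) : {set T} :=
  (A :\: B) :|: (B :\: A).

Lemma symdiffA (T : finType) : associative (@symdiff T).
Proof. by move=> A B C; apply/setP=> x; rewrite !inE; do 3!case: (_ \in _). Qed.

Lemma symdiffC (T : finType) : commutative (@symdiff T).
Proof. by move=> A B; rewrite /symdiff setUC. Qed.

Lemma symdiff0s (T : finType) : left_id set0 (@symdiff T).
Proof. by move=> A; rewrite /symdiff set0D setD0 set0U. Qed.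

HB.instance Definition _ (T : finType) :=
  Monoid.isComLaw.Build {set T} set0 (@symdiff T)
    (@symdiffA T) (@symdiffC T) (@symdiff0s T).

Definition family_symdiff (G : sgraph) (D : {set subgraph G}) : {set edge G} :=
  \big[@symdiff (edge G)/set0]_(C in D) subgraph_edges C.

(* Main.v *)
Require Import Defs.
From mathcomp Require Import all_boot all_order all_algebra.

Import GRing.Theory.

(** A signing is a vector x over F_2 indexed by the edges, and "every 2k-cycle
    is unbalanced" is the linear system: for every 2k-cycle C, the sum of x
    over the edges of C equals 1. By the Fredholm alternative the system is
    solvable unless some combination of its equations reads 0 = 1; over F_2 a
    combination is a subfamily of cycles, its left side vanishes exactly when
    the subfamily is a dependence, and its right side is the parity of the
    size. *)

Section LinearAlgebra.
Local Open Scope ring_scope.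

(** Written as x A = u, the system is solvable when u lies in the row space of [A]. Otherwise
    [u *m cokermx A] has a nonzero entry, and the column of [cokermx A] at that entry is annihilated
    by [A] but not by u. *)
Lemma fredholm_alternative (F : fieldType) (I J : finType)
    (a : I -> J -> F) (b : J -> F) :
  (exists x : I -> F, forall j, \sum_i x i * a i j = b j) \/
  (exists2 y : J -> F, forall i, \sum_j a i j * y j = 0 & \sum_j b j * y j != 0).
Proof.
pose A : 'M[F]_(#|I|, #|J|) := \matrix_(i, j) a (enum_val i) (enum_val j).
pose u : 'rV[F]_#|J| := \row_j b (enum_val j).
have [/submxP[x ux] | /negP uA] := boolP (u <= A)%MS.
  left; exists (fun i => x 0 (enum_rank i)) => j.
  have := congr1 (fun v : 'rV_#|J| => v 0 (enum_rank j)) ux.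
  rewrite !mxE enum_rankK => ->.
  rewrite (reindex _ (onW_bij _ (@enum_val_bij I))) /=.
  by apply: eq_bigr => i _; rewrite mxE enum_valK enum_rankK.
right.
have [j uj] : exists j, (u *m cokermx A) 0 j != 0.
  apply/existsP; apply: contraT; rewrite negb_exists => /forallP u0.
  case: uA; rewrite submxE; apply/eqP/rowP => j; rewrite [RHS]mxE.
  by apply/eqP; rewrite -[_ == _]negbK.
exists (fun l => cokermx A (enum_rank l) j) => [i|].
  have := congr1 (fun B : 'M_(#|I|, #|J|) => B (enum_rank i) j) (mulmx_coker A).
  rewrite mxE [RHS]mxE => A0; rewrite -[RHS]A0.
  rewrite (reindex _ (onW_bij _ (@enum_val_bij J))) /=.
  by apply: eq_bigr => l _; rewrite enum_valK [A _ _]mxE enum_rankK.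
rewrite (reindex _ (onW_bij _ (@enum_val_bij J))) /=.
congr (_ != 0): uj; rewrite mxE.
by apply: eq_bigr => l _; rewrite [u _ _]mxE enum_valK.
Qed.

Lemma natr_F2_eq0 (n : nat) : (n%:R == 0 :> 'F_2) = ~~ odd n.
Proof. by rewrite -(dvdn_pcharf (pchar_Fp (isT : prime 2))) dvdn2. Qed.

Lemma F2_boolE (x : 'F_2) : x = (x != 0)%:R.
Proof. by apply/val_inj; case: x => [[|[|[]]]]. Qed.

End LinearAlgebra.

Section Cycles.
Local Open Scope ring_scope.
Variable G : sgraph.
Implicit Types (D K : {set subgraph G}) (C : subgraph G) (f : edge G).

(** The parity of the number of members through each edge is the common form to which both the F_2
    sum and the symmetric difference are reduced. *)
Lemma sum_incidence_eq0 D :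
  (\sum_(C in D) incidence C = 0) <->
  (forall f, ~~ odd #|[set C in D | f \in subgraph_edges C]|).
Proof.
have sumE f : (\sum_(C in D) incidence C) f =
    (#|[set C in D | f \in subgraph_edges C]|)%:R.
  rewrite sum_ffunE -sum1_card natr_sum big_mkcond [RHS]big_mkcond /=.
  by apply: eq_bigr => C _; rewrite inE ffunE; do 2!case: (_ \in _).
split=> [D0 f|D0]; first by rewrite -natr_F2_eq0 -sumE D0 ffunE.
by apply/ffunP => f; rewrite sumE [RHS]ffunE; apply/eqP; rewrite natr_F2_eq0.
Qed.

Lemma in_family_symdiff D f :
  (f \in family_symdiff D) = odd #|[set C in D | f \in subgraph_edges C]|.
Proof.
transitivity (\big[addb/false]_(C in D) (f \in subgraph_edges C)).
  apply: (big_morph (fun A : {set edge G} => f \in A)) => [A B|]; rewrite !inE //.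
  by do 2!case: (_ \in _).
rewrite -sum1_card (big_morph odd oddD (erefl _)) big_mkcond [RHS]big_mkcond /=.
by apply: eq_bigr => C _; rewrite inE; do 2!case: (_ \in _).
Qed.

Lemma family_symdiff_eq0 D :
  family_symdiff D = set0 <-> \sum_(C in D) incidence C = 0.
Proof.
split=> [D0|/sum_incidence_eq0 D0].
  by apply/sum_incidence_eq0 => f; rewrite -in_family_symdiff D0 inE.
by apply/setP => f; rewrite in_family_symdiff inE; apply/negbTE.
Qed.

(** The product of the signs of all members is computed twice: by members it is (-1)^|D|, by edges
    it is 1. *)
Lemma unbalanced_even (sigma : signing G) D :
  (forall C, C \in D -> unbalanced sigma C) ->
  \sum_(C in D) incidence C = 0 -> ~~ odd #|D|.
Proof.
move=> neg /sum_incidence_eq0 even_deg.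
have: \prod_(C in D) cycle_sign sigma C = 1.
  (* After the exchange, each edge sign is raised to the number of members through that edge, which
     is even. *)
  rewrite /cycle_sign (exchange_big_dep predT) //= big1 // => f _.
  rewrite -big_set /= prodr_const -[#|_|]even_halfK ?even_deg // -mul2n exprM.
  by case: (sgn_ofP sigma f) => ->; rewrite ?sqrrN !expr1n.
rewrite (eq_bigr (fun=> -1)) // prodr_const -signr_odd.
by case: (odd _).
Qed.

Lemma unbalanced_signing_or_odd_dependence K :
  (exists sigma : signing G, forall C, C \in K -> unbalanced sigma C) \/
  (exists D, [/\ D \subset K, \sum_(C in D) incidence C = 0 & odd #|D|]).
Proof.
(* The equations are indexed by all subgraphs; the factor [C \in K] turns those outside [K] into 0 =
   0. *)
have [[x xK]|[y y0 y1]] := fredholm_alternative _ _ _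
  (fun f C => ((C \in K) && (f \in subgraph_edges C))%:R : 'F_2)
  (fun C => (C \in K)%:R).
  left; pose s f : int := (-1) ^+ (x f != 0).
  have sP f : s f = 1 \/ s f = -1 by rewrite /s; case: (x f != 0); [right | left].
  exists (Signing sP) => C CK.
  rewrite /unbalanced /cycle_sign /= prodrXr -signr_odd.
  suff -> : odd (\sum_(f in subgraph_edges C) (x f != 0)%R) by [].
  (* The number of negative edges of [C], read in F_2, is the left side of the equation of [C],
     hence 1. *)
  rewrite -[odd _]negbK -natr_F2_eq0 natr_sum.
  move: (xK C); rewrite CK => sum1; rewrite [X in X != 0](_ : _ = 1) //.
  rewrite -[RHS]sum1 big_mkcond; apply: eq_bigr => f _ /=.
  by case: (_ \in _); rewrite ?mulr1 ?mulr0 -?F2_boolE.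
(* Over F_2 the multiplier [y] is the indicator of its support; its values off [K] are arbitrary, so
   the support is cut down to [K]. *)
right; exists [set C in K | y C != 0].
split; first by apply/subsetP => C; rewrite inE => /andP[].
  apply/ffunP => f; rewrite sum_ffunE [RHS]ffunE -[RHS](y0 f) big_mkcond /=.
  apply: eq_bigr => C _; rewrite inE ffunE {2}[y C]F2_boolE -natrM mulnb.
  by case: (C \in K) => //=; rewrite andbC; case: (y C != 0).
rewrite -[odd _]negbK -natr_F2_eq0 -sum1_card natr_sum big_mkcond /=.
congr (_ != 0): y1; apply: eq_bigr => C _; rewrite inE {1}[y C]F2_boolE.
by rewrite -natrM mulnb; case: (_ && _).
Qed.

End Cycles.

Theorem theorem2p1 (k : nat) (hk : 2 <= k) (G : sgraph) :
  ((exists sigma : signing G,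
      forall C : subgraph G, C \in cycles (2 * k) G -> unbalanced sigma C)
   <-> ~ (exists D : {set subgraph G}, dependence (2 * k) D /\ odd #|D|))
  /\
  ((exists sigma : signing G,
      forall C : subgraph G, C \in cycles (2 * k) G -> unbalanced sigma C)
   <-> (forall D : {set subgraph G},
          D \subset cycles (2 * k) G -> family_symdiff D = set0 -> ~~ odd #|D|)).
Proof.
(* This settles both converses: an odd dependence would contradict either hypothesis, so a signing
   remains. *)
have alt := unbalanced_signing_or_odd_dependence G (cycles (2 * k) G).
split; split.
- move=> [sigma neg] [D [[DK D0]]]; apply/negP.
  by apply: (unbalanced_even _ sigma _ _ D0) => C /(subsetP DK); exact: neg.
- by case: alt => // -[D [DK D0 oD]] []; exists D.
- move=> [sigma neg] D DK /family_symdiff_eq0.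
  by apply: unbalanced_even => C /(subsetP DK); exact: neg.
- case: alt => // -[D [DK /family_symdiff_eq0 D0 oD]] /(_ D DK D0).
  by rewrite oD.
Qed.
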